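(* Let $m\geq2$ and let $P$ be a finite nonempty set of primes. For every $p\in P$: if $n$ is a $P$-number which is $m$-Carmichael, then $p^{v_{m,P}(p)}\,n$ is also a $P$-number which is $m$-Carmichael; i.e. the set of $P$-numbers which are $m$-Carmichael is invariant under multiplication by $p^{v_{m,P}(p)}$.
   Context: For $k\geq1$, $\Phi_k(X)$ denotes the $k$th cyclotomic polynomial. For $n\in\mathbb N$ set $D_m(n)=\prod_{j=1}^m\Phi_j(n)$, $\nabla_m(n)=\prod_{q\mid n}q^{\lceil\log_q m\rceil-1}$ (product over prime divisors $q$ of $n$), and $K_m(n)=n\,\nabla_m(n)\,D_m(n)$. A composite $n\in\mathbb N$ is called $m$-Carmichael if $A^{K_m(n)}=I$ for all $A\in\mathrm{GL}(m,\mathbb Z/n\mathbb Z)$. A $P$-number is an $n\in\mathbb N$ whose set of prime divisors is exactly $P$. Let $D_m(P)=\mathrm{lcm}\{D_m(q):q\in P\}$, and write $D_m(P)=D_m'(P)D_m''(P)$ where $D_m'(P)$ is a product of primes in $P$ and $D_m''(P)$ is coprime to every prime in $P$. For $p\in P$, $v_{m,P}(p)$ denotes the multiplicative order of $p$ modulo $D_m''(P)$ in $(\mathbb Z/D_m''(P)\mathbb Z)^\times$. *)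

(* Defs.v *)
From HB Require Import structures.
From mathcomp Require Import all_boot all_order all_algebra all_fingroup.
From mathcomp Require Import all_solvable all_field finmap.
Set Implicit Arguments.
Unset Strict Implicit.
Unset Printing Implicit Defensive.
Import Order.TTheory GRing.Theory Num.Theory.

Local Open Scope nat_scope.

(* Truncated to nat by the absolute value so that it can serve as an exponent;
   no information is lost for n > 1, see Dm_prod below. *)
Definition Dm (m n : nat) : nat :=
  absz (\prod_(1 <= j < m.+1) ('Phi_j).[n%:Z])%R.

(* up_log q m is the least e with m <= q ^ e, i.e. the ceiling of log_q m. *)
Definition nablam (m n : nat) : nat :=
  \prod_(q <- primes n) q ^ (up_log q m - 1).

Definition Km (m n : nat) : nat := n * nablam m n * Dm m n.

Definition composite (n : nat) : Prop := 1 < n /\ ~~ prime n.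

(* {'GL_m[R]} has underlying matrix type 'M[R]_(m.-1.+1), so it is GL(m, R)
   for m > 0; 'Z_n is Z/nZ because n > 1. *)
Definition m_Carmichael (m n : nat) : Prop :=
  composite n /\ forall A : {'GL_m['Z_n]}, (A ^+ Km m n = 1)%g.

Definition P_number (P : {fset nat}) (n : nat) : Prop :=
  0 < n /\ primes n =i P.

Definition DmP (m : nat) (P : {fset nat}) : nat :=
  \big[lcmn/1]_(q <- P) Dm m q.

Definition DmP' (m : nat) (P : {fset nat}) : nat :=
  (DmP m P)`_[pred q in P].

Definition DmP'' (m : nat) (P : {fset nat}) : nat :=
  (DmP m P)`_([pred q in P]^').

(* The order of the class of a in the unit group of Z/dZ, for a coprime to d.
   d = 1 is singled out because 'Z_1 is Z/2Z; the unit group of the zero ring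
   is trivial. *)
Definition mulorder (d a : nat) : nat :=
  if 1 < d then #[insubd (1%g : {unit 'Z_d}) (a%:R : 'Z_d)%R]%g else 1.

Definition vmP (m : nat) (P : {fset nat}) (p : nat) : nat :=
  mulorder (DmP'' m P) p.

Lemma Cyclotomic_gt0 (j n : nat) : 1 < n -> (0 < ('Phi_j).[n%:Z])%R.
Proof.
move=> n_gt1; elim/ltn_ind: j => j IHj.
have [-> | j_gt0] := posnP j; first by rewrite Cyclotomic0 hornerE.
have/(congr1 (horner^~ n%:Z)%R) := prod_Cyclotomic j_gt0.
rewrite (big_rem j) -?dvdn_divisors //= hornerM horner_prod !hornerE => defj.
have rhs_gt0 : (0 < n%:Z ^+ j - 1)%R.
  by rewrite subr_gt0 exprn_egt1 // -lt0n.
rewrite -defj pmulr_lgt0 // in rhs_gt0.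
rewrite big_seq; apply: prodr_gt0 => d.
rewrite mem_rem_uniq ?divisors_uniq // inE -dvdn_divisors // => /andP[ndj dvj].
by apply: IHj; rewrite ltn_neqAle ndj dvdn_leq.
Qed.

Lemma Dm_prod (m n : nat) : 1 < n ->
  ((Dm m n)%:Z = \prod_(1 <= j < m.+1) ('Phi_j).[n%:Z])%R.
Proof.
move=> n_gt1; rewrite /Dm gez0_abs //.
by apply: prodr_ge0 => j _; apply/ltW/Cyclotomic_gt0.
Qed.

Lemma DmP_gt0 (m : nat) (P : {fset nat}) :
  (forall q, q \in P -> prime q) -> 0 < DmP m P.
Proof.
move=> hP; rewrite /DmP big_seq.
apply: (big_ind (fun d => 0 < d)) => // [x y x0 y0 | q /hP /prime_gt1 q_gt1].
  by rewrite lcmn_gt0 x0.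
rewrite -ltz_nat Dm_prod //; apply: prodr_gt0 => j _; exact: Cyclotomic_gt0.
Qed.

Lemma DmP_split (m : nat) (P : {fset nat}) :
  (forall q, q \in P -> prime q) -> DmP m P = DmP' m P * DmP'' m P.
Proof. by move=> hP; rewrite /DmP' /DmP'' partnC ?DmP_gt0. Qed.

Lemma mulorderP (d a k : nat) : 0 < d -> coprime a d ->
  (a ^ k == 1 %[mod d]) = (mulorder d a %| k).
Proof.
move=> d_gt0 cad; rewrite /mulorder; case: (ltnP 1 d) => [d_gt1 | d_le1]; last first.
  have -> : d = 1 by apply/eqP; rewrite eqn_leq d_le1.
  by rewrite !modn1 dvd1n.
rewrite order_dvdn -val_eqE FinRing.val_unitX FinRing.val_unit1.
rewrite insubdK; last by rewrite -topredE /= unitZpE // coprime_sym.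
have Zeq x y : ((x%:R : 'Z_d) == y%:R)%R = (x == y %[mod d]).
  by rewrite -!(val_Zp_nat d_gt1).
by rewrite -natrX (Zeq _ 1).
Qed.

(* Main.v *)
(** Put [N = p ^ v * n] and let [a] be the order of a matrix [A] in GL(m, Z/N).
    Since [A ^+ K_m(n)] is the identity modulo [n], and raising to the power [p] gains a
    factor [p] in such a congruence, [a] divides [N * nabla_m(n) * D_m(n)].  On the other
    hand, the eigenvalues of [A] modulo a prime [q] of [P] have degree at most [m] over
    F_q, so their orders divide [D_m(q)]; hence [a] divides [D_m(P)] times a product of
    primes of [P].  As [D_m(n)] is coprime to [n], the [P]-part of [a] divides
    [N * nabla_m(n)], while its prime-to-[P] part divides both [D_m(n)] and [D_m''(P)].
    By the choice of [v], [N] is congruent to [n] modulo [D_m''(P)], and thus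
    the prime-to-[P] part also divides [D_m(N)]. *)

Require Import Defs.
From mathcomp Require Import all_boot all_order all_algebra all_fingroup.
From mathcomp Require Import all_solvable all_field finmap.

Set Implicit Arguments.
Unset Strict Implicit.
Unset Printing Implicit Defensive.
From mathcomp Require Import zify.
Import GRing.Theory.

Local Open Scope nat_scope.

(** * Congruences to 1 modulo an integer *)

Section OneModulo.
Local Open Scope ring_scope.

(** It is applied to integer matrices: a matrix over Z/N is lifted to one over the integers, whose
    congruences modulo divisors of N can then be compared. *)
Definition eq1_mod (R : pzRingType) (d : nat) (x : R) := exists c : R, x = 1 + c *+ d.

Lemma eq1_mod_expr_expand (R : pzRingType) (d k : nat) (x c : R) :
  x = 1 + c *+ d -> exists e, x ^+ k = 1 + (c *+ k + e *+ d) *+ d.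
Proof.
move=> xE; elim: k => [|k [e IHk]]; first by exists 0; rewrite mulr0n mul0rn addr0 mul0rn addr0.
exists (e + c * (c *+ k + e *+ d)); rewrite exprS IHk xE mulrDr mulr1 mulrDl mul1r.
rewrite -addrA; congr (_ + _); rewrite mulrnAr mulrnAl -!mulrnDl; congr (_ *+ d).
by rewrite mulrS mulrnDl !addrA.
Qed.

Lemma eq1_modX (R : pzRingType) (d k : nat) (x : R) :
  eq1_mod d x -> eq1_mod d (x ^+ k).
Proof. by case=> c /eq1_mod_expr_expand-/(_ k)[e ->]; exists (c *+ k + e *+ d). Qed.

Lemma eq1_mod_expr_dvd (R : pzRingType) (d k l : nat) (x : R) :
  (k %| l)%N -> eq1_mod d (x ^+ k) -> eq1_mod d (x ^+ l).
Proof. by move=> /dvdnP[t ->]; rewrite mulnC exprM; apply: eq1_modX. Qed.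

Lemma eq1_mod_dvd (R : pzRingType) (d e : nat) (x : R) :
  (d %| e)%N -> eq1_mod e x -> eq1_mod d x.
Proof. by move=> /dvdnP[t ->] [c ->]; exists (c *+ t); rewrite mulrnA. Qed.

(** In the expansion of a [p]-th power, the linear term gains the factor [p] and the remainder has a
    second factor [d], itself a multiple of [p]. The new modulus is again a multiple of [p], so the
    step iterates. *)
Lemma eq1_modX_lift (R : pzRingType) (d p k : nat) (x : R) :
  (p %| d)%N -> eq1_mod d x -> eq1_mod (p ^ k * d) (x ^+ (p ^ k)).
Proof.
move=> pd xd; elim: k => [|k [c IHk]]; first by rewrite mul1n expr1.
have /dvdnP[t tE] : (p %| p ^ k * d)%N by rewrite dvdn_mull.
have [e] := eq1_mod_expr_expand p IHk; rewrite -exprM -expnSr => ->.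
exists (c + e *+ t); rewrite expnS -mulnA; move: (p ^ k * d)%N tE => D ->.
by rewrite (mulrnA _ p) [(c + _) *+ p]mulrnDl -(mulrnA e).
Qed.

Lemma eq1_mod_rmorph (R S : pzRingType) (f : {rmorphism R -> S}) (d : nat) (x : R) :
  d%:R = 0 :> S -> eq1_mod d x -> f x = 1.
Proof.
by move=> d0 [c ->]; rewrite rmorphD rmorph1 rmorphMn -mulr_natr d0 mulr0 addr0.
Qed.

Lemma eq1_mod_int_mxP (m d : nat) (M : 'M[int]_m.+1) :
  eq1_mod d M <-> forall i j, (d %| (M - 1) i j)%Z.
Proof.
split=> [[c ->] i j | dM].
  by rewrite addrC addKr -scaler_nat !mxE natz; apply: dvdz_mulr.
exists (\matrix_(i, j) ((M - 1) i j %/ d)%Z); apply/(canRL (subrKC _))/matrixP=> i j.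
by rewrite -scaler_nat !mxE [d%:R]natz mulrC divzK //; have := dM i j; rewrite !mxE.
Qed.

Lemma eq1_mod_partn (m d : nat) (M : 'M[int]_m.+1) : (0 < d)%N ->
  (forall q, q \in primes d -> eq1_mod (d`_q)%N M) -> eq1_mod d M.
Proof.
move=> d0 dM; apply/eq1_mod_int_mxP => i j; rewrite dvdzE.
by apply/dvdn_partP=> // q /dM/eq1_mod_int_mxP/(_ i j); rewrite dvdzE.
Qed.

Lemma intr_Zp_eq0 (d : nat) (x : int) : (1 < d)%N ->
  (x%:~R == 0 :> 'Z_d) = (d %| x)%Z.
Proof.
move=> d1; have nat_eq0 k : (k%:R == 0 :> 'Z_d) = (d %| k)%N.
  by rewrite -val_eqE /= val_Zp_nat.
rewrite dvdzE; case: x => k; first exact: nat_eq0.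
by rewrite NegzE mulrNz oppr_eq0 -pmulrn nat_eq0 abszN.
Qed.

Lemma map_mx_Zp_eq1 (m d : nat) (M : 'M[int]_m.+1) : (1 < d)%N ->
  map_mx (intr : int -> 'Z_d) M = 1 -> eq1_mod d M.
Proof.
move=> d1 M1; apply/eq1_mod_int_mxP => i j; rewrite -intr_Zp_eq0 //.
have := congr1 (fun B : 'M_m.+1 => (B - 1) i j) M1.
by rewrite subrr -(rmorph1 (map_mx intr)) -rmorphB !mxE => ->.
Qed.

Lemma natr_Zp_mx_eq0 (m d : nat) : (1 < d)%N -> d%:R = 0 :> 'M['Z_d]_m.+1.
Proof.
by move=> d1; rewrite -(rmorph_nat (@scalar_mx 'Z_d m.+1)) pchar_Zp ?rmorph0.
Qed.

Definition mx_repr (m d : nat) (A : 'M['Z_d]_m) : 'M[int]_m :=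
  map_mx (fun z : 'Z_d => (z : nat)%:Z) A.

Lemma mx_reprK (m d : nat) (A : 'M['Z_d]_m) : map_mx intr (mx_repr A) = A.
Proof. by apply/matrixP=> i j; rewrite !mxE; apply: natr_Zp. Qed.

End OneModulo.

(** * Divisibility properties of D_m *)

Section Cyclotomic.
Local Open Scope ring_scope.

Definition Dpoly (m : nat) : {poly int} := \prod_(1 <= j < m.+1) 'Phi_j.

Lemma Dm_horner (m n : nat) : (1 < n)%N -> (Dm m n)%:Z = (Dpoly m).[n%:Z].
Proof. by move=> n1; rewrite Dm_prod // horner_prod. Qed.

Lemma dvdz_horner_sub (f : {poly int}) (a b : int) : (a - b %| f.[a] - f.[b])%Z.
Proof.
have /factor_theorem[g gE] : root (f - f.[b]%:P) b by rewrite /root !hornerE subrr.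
have := congr1 (horner^~ a) gE; rewrite !hornerE => ->; exact: dvdz_mull.
Qed.

(** X^j - 1 is the product of the Phi_d over the divisors d of j, all of which lie among the indices
    1, ..., m of D_m. *)
Lemma dvdn_expB1_Dm (m j q : nat) : (1 < q)%N -> (0 < j <= m)%N ->
  (q ^ j - 1 %| Dm m q)%N.
Proof.
move=> q1 /andP[j0 jm].
suff: (q%:Z ^+ j - 1 %| (Dm m q)%:Z)%Z.
  by rewrite -{1}[q%:Z]natz -natrX natz subzn ?expn_gt0 1?ltnW.
rewrite Dm_horner // /Dpoly.
have := congr1 (horner^~ q%:Z) (prod_Cyclotomic j0).
rewrite horner_prod !hornerE => <-.
rewrite horner_prod (bigID (fun d => d %| j)%N) /=; apply: dvdz_mulr.
rewrite -big_filter (perm_big (divisors j)) //; apply: uniq_perm.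
- by rewrite filter_uniq ?iota_uniq.
- exact: divisors_uniq.
move=> d; rewrite mem_filter mem_index_iota -dvdn_divisors // ltnS.
by apply: andb_idr => dj; rewrite (dvdn_gt0 j0 dj) (leq_trans (dvdn_leq j0 dj)).
Qed.

(** Each factor Phi_j(n) divides n^j - 1, which is coprime to n. *)
Lemma coprime_Dm (m n : nat) : (1 < n)%N -> coprime n (Dm m n).
Proof.
move=> n1; suff: coprimez n%:Z (Dm m n)%:Z by rewrite coprimezE.
rewrite Dm_prod // big_nat.
apply: (big_ind (fun x => coprimez n%:Z x)); first by rewrite coprimezE coprimen1.
- by move=> x y; rewrite coprimezMr => -> ->.
move=> j /andP[j0 _].
have := congr1 (horner^~ n%:Z) (prod_Cyclotomic j0).
rewrite (big_rem j) -?dvdn_divisors //= hornerM !hornerE => jE.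
have : coprimez n%:Z (n%:Z ^+ j - 1).
  case: j j0 {jE} => // j _; rewrite coprimezE -[coprime _ _]/(coprimez _ _).
  apply/coprimezP; exists (n%:Z ^+ j, -1) => /=; rewrite exprS; by lia.
by rewrite -jE coprimezMr => /andP[].
Qed.

(** D_m is an integer polynomial, so it respects congruences modulo [d]. *)
Lemma dvdn_Dm_congr (m d a b : nat) : (1 < a)%N -> (1 < b)%N ->
  a = b %[mod d] -> (d %| Dm m a)%N = (d %| Dm m b)%N.
Proof.
move=> a1 b1 ab; rewrite -[LHS]/(d %| (Dm m a)%:Z)%Z -[RHS]/(d %| (Dm m b)%:Z)%Z.
have dab : (d %| (Dm m a)%:Z - (Dm m b)%:Z)%Z.
  rewrite !Dm_horner //; apply: dvdz_trans (dvdz_horner_sub _ _ _).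
  by rewrite -eqz_mod_dvd !modz_nat ab.
by rewrite -[(Dm m a)%:Z](subrK (Dm m b)%:Z) rpredDl.
Qed.

End Cyclotomic.

(** * Orders of invertible matrices over F_q *)

Section PrimeField.
Local Open Scope ring_scope.

(* The q-power map preserves the roots of [f], of which there are fewer than [size f], so
   two of the first [size f] iterates of a root coincide. *)
Lemma root_Fp_unity (q : nat) (K : fieldType) (iota : {rmorphism 'F_q -> K})
    (f : {poly 'F_q}) (x : K) :
  prime q -> f != 0 -> x != 0 -> root (map_poly iota f) x ->
  exists2 j, (0 < j < size f)%N & x ^+ (q ^ j - 1) = 1.
Proof.
move=> q_pr f0 x0 fx.
have qK : q \in [pchar K] := rmorph_pchar iota (pchar_Fp q_pr).
pose frob := pFrobenius_aut qK.
have root_frob y : root (map_poly iota f) y -> root (map_poly iota f) (frob y).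
  have {2}<- : map_poly frob (map_poly iota f) = map_poly iota f.
    rewrite -map_poly_comp; apply: eq_map_poly => a /=.
    rewrite /frob pFrobenius_autE -rmorphXn; congr (iota _).
    by rewrite -[RHS]expf_card card_Fp.
  by rewrite !rootE => /eqP fy; rewrite (horner_map frob) fy rmorph0.
have iter_frob k y : iter k frob y = y ^+ (q ^ k).
  by elim: k => //= k ->; rewrite /frob pFrobenius_autE -exprM expnSr.
have : looping frob x (size f).-1.
  apply: contraTT isT; rewrite -looping_uniq => x_uniq.
  have := max_poly_roots _ _ x_uniq; rewrite prednK ?lt0n ?size_poly_eq0 //.
  rewrite size_traject => /(_ (map_poly iota f)); rewrite map_poly_eq0 size_map_poly ltnn.
  apply=> //; apply/allP=> y /trajectP[k _ ->]; elim: k => //= k; exact: root_frob.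
move=> /loopingP/(_ (size f).-1)/trajectP[i lt_i].
rewrite -[(size f).-1 in LHS](subnKC (ltnW lt_i)) iterD => eq_iter.
exists ((size f).-1 - i)%N; first by rewrite subn_gt0 lt_i; lia.
(* Frobenius is injective, so the [i] iterations common to both sides cancel. *)
have : iter ((size f).-1 - i) frob x = x.
  move: (_ - i)%N eq_iter => j; elim: i {lt_i} => //= i IHi.
  by move/(fmorph_inj frob)/IHi.
rewrite iter_frob => xq; apply: (mulfI x0).
by rewrite mulr1 -exprS subn1 prednK ?expn_gt0 ?prime_gt0.
Qed.

(** Every eigenvalue in an algebraic closure is a root of X^D - 1. Multiplicities are at most m + 1
    <= q^(m+1), so the characteristic polynomial divides (X^D - 1)^(q^(m+1)), which is X^(D q^(m+1))
    - 1 in characteristic q; Cayley-Hamilton concludes. *)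
Lemma unitmx_Fp_expr (q m D : nat) (A : 'M['F_q]_m.+1) : prime q -> A \in unitmx ->
  (forall j, (0 < j <= m.+1)%N -> (q ^ j - 1 %| D)%N) -> A ^+ (D * q ^ m.+1) = 1.
Proof.
move=> q_pr A_unit qD.
have [K [iota _]] := countable_algebraic_closure 'F_q.
have qK : q \in [pchar K] := rmorph_pchar iota (pchar_Fp q_pr).
apply: (map_mx_inj (f := iota)); rewrite rmorph1 rmorphXn /=; set B := map_mx iota A.
pose f := char_poly A.
have f0 : f != 0 by rewrite monic_neq0 ?char_poly_monic.
have BE : char_poly B = map_poly iota f by rewrite map_char_poly.
have [rs rsE] := closed_field_poly_normal (char_poly B).
rewrite (eqP (char_poly_monic B)) scale1r in rsE.
have size_rs : size rs = m.+1.
  by apply: succn_inj; rewrite -(size_char_poly B) rsE size_prod_XsubC.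
have dvd_rs : (char_poly B %| ('X^D - 1) ^+ m.+1)%R.
  rewrite rsE -size_rs -[size rs]count_predT -iter_mulr_1 -big_const_seq.
  rewrite big_seq [X in _ %| X]big_seq; apply: (big_ind2 (fun g h => g %| h)) => //.
    by move=> g1 h1 g2 h2; apply: dvdp_mul.
  move=> x x_rs; rewrite dvdp_XsubCl rootE !hornerE subr_eq0.
  have fx : root (map_poly iota f) x by rewrite -BE rsE root_prod_XsubC.
  have x0 : x != 0.
    apply: contraTneq fx => ->; rewrite rootE horner_coef0 coef_map char_poly_det.
    rewrite fmorph_eq0 mulf_neq0 ?signr_eq0 //.
    by move: A_unit; rewrite unitmxE unitfE.
  have [j] := root_Fp_unity q_pr f0 x0 fx; rewrite size_char_poly ltnS => jm xj.
  by have /dvdnP[t ->] := qD j jm; rewrite mulnC exprM xj expr1n.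
have qm : [pchar {poly K}].-nat (q ^ m.+1)%N.
  by rewrite pnatX pnatE // (rmorph_pchar (polyC : {rmorphism K -> {poly K}})).
have : (char_poly B %| 'X^(D * q ^ m.+1) - 1)%R.
  apply: dvdp_trans dvd_rs _; apply: (@dvdp_trans _ (('X^D - 1) ^+ (q ^ m.+1))).
    by apply: dvdp_exp2l; apply: ltnW; apply: ltn_expl; apply: prime_gt1.
  have -> : 'X^(D * q ^ m.+1) = ('X^D - 1) ^+ (q ^ m.+1) + 1 :> {poly K}.
    by rewrite exprM -{1}['X^D](subrK 1) exprDn_pchar // expr1n.
  by rewrite addrK.
case/dvdpP => g /(congr1 (horner_mx B)).
rewrite rmorphM /= Cayley_Hamilton mulr0 rmorphB rmorph1 rmorphXn /= horner_mx_X.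
by move/eqP; rewrite subr_eq0 => /eqP.
Qed.

End PrimeField.

(** For each prime q dividing N, the factor D * N^(m+1) gives a congruence modulo q, and N^N lifts
    it beyond the q-part of N, as the q-adic valuation of N is less than N. The exponent is crude,
    but besides D it involves only primes of N. *)
Lemma eq1_mod_expr_unit (m N D : nat) (M V : 'M[int]_m.+1) : 0 < N ->
  eq1_mod N (M * V)%R ->
  (forall q j, q \in primes N -> 0 < j <= m.+1 -> q ^ j - 1 %| D) ->
  eq1_mod N (M ^+ (D * N ^ m.+1 * N ^ N))%R.
Proof.
move=> N0 MV qD; apply: eq1_mod_partn => // q q_N.
have := q_N; rewrite mem_primes => /and3P[q_pr _ qN].
have F_q0 : (q%:R = 0 :> 'M['F_q]_m.+1)%R.
  by rewrite -(rmorph_nat (@scalar_mx 'F_q m.+1)) pchar_Fp_0 // rmorph0.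
have Mq : eq1_mod q (M ^+ (D * N ^ m.+1))%R.
  apply: (@eq1_mod_expr_dvd _ _ (D * q ^ m.+1)); first by rewrite dvdn_mul ?dvdn_exp2r.
  apply/eq1_mod_int_mxP => i j; rewrite (dvdz_pcharf (pchar_Fp q_pr)).
  pose f : {rmorphism int -> 'F_q} := intr.
  have := eq1_mod_rmorph (map_mx f) F_q0 (eq1_mod_dvd qN MV).
  rewrite rmorphM /= => /mulmx1_unit[Mu _].
  have := unitmx_Fp_expr q_pr Mu (fun j => qD q j q_N).
  rewrite -rmorphXn => /= M1.
  have := congr1 (fun B : 'M_m.+1 => (B - 1) i j)%R M1.
  by rewrite subrr -(rmorph1 (map_mx f)) -rmorphB !mxE => ->.
rewrite exprM; apply: (@eq1_mod_expr_dvd _ _ (q ^ N)); first exact: dvdn_exp2r.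
apply: eq1_mod_dvd (eq1_modX_lift N (dvdnn q) Mq).
by rewrite dvdn_mulr // p_part dvdn_exp2l // ltnW // ltn_logl.
Qed.

Lemma eq_primes_expM (p n : nat) : p \in primes n -> 0 < n ->
  forall k, primes (p ^ k * n) =i primes n.
Proof.
move=> pn n0 k q; have := pn; rewrite (mem_primes p) => /and3P[p_pr _ _].
rewrite primesM ?expn_gt0 ?(prime_gt0 p_pr) //; case: k => [|k]; first by rewrite in_nil.
by rewrite primesX // primes_prime // inE; apply: orb_idl => /eqP->.
Qed.

Theorem theorem3p5 (m : nat) (P : {fset nat})
    (hm : 2 <= m) (hP0 : P != fset0) (hP : forall q : nat, q \in P -> prime q)
    (p : nat) (hp : p \in P) (n : nat)
    (hn : P_number P n) (hC : m_Carmichael m n) :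
  P_number P (p ^ vmP m P p * n) /\ m_Carmichael m (p ^ vmP m P p * n).
Proof.
case: m hm hC => // m _ [[n1 n_comp] hC]; case: hn => n0 nP.
pose N := p ^ vmP m.+1 P p * n; rewrite -/N.
have p_pr := hP p hp.
have pn : p \in primes n by rewrite nP.
have NPn : primes N =i primes n by apply: eq_primes_expM.
have N0 : 0 < N by rewrite muln_gt0 expn_gt0 prime_gt0.
have nN : n %| N by apply: dvdn_mull.
have N1 : 1 < N := leq_trans n1 (dvdn_leq N0 nN).
split; first by split=> // q; rewrite NPn nP.
split.
  split=> //; apply: contra n_comp => N_pr.
  suff -> : n = N by []; apply/(prime_nt_dvdP N_pr) => //.
  by rewrite neq_ltn n1 orbT.
pose pi : nat_pred := [pred q in P].
have piN : pi.-nat N.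
  by apply/pnatP=> // q q_pr qN; rewrite inE -nP -NPn mem_primes q_pr N0.
have nablaE : nablam m.+1 N = nablam m.+1 n.
  by rewrite /nablam (irr_sorted_eq ltn_trans ltnn (sorted_primes _) (sorted_primes _) NPn).
have pi_nabla : pi.-nat (nablam m.+1 n).
  rewrite /nablam big_seq; apply: (big_ind (fun x => pi.-nat x)) => // [x y x_pi y_pi | q].
    by rewrite pnatM x_pi.
  by rewrite nP => qP; rewrite pnatX pnatE ?hP // inE qP.
move=> A; apply/eqP; rewrite -order_dvdn; set a := #[A]%g.
have a0 : 0 < a by apply: order_gt0.
pose M := mx_repr (val A); pose V := mx_repr (val A^-1%g).
have ME : map_mx intr M = val A by apply: mx_reprK.
have MVN : eq1_mod N (M * V)%R.
  apply: map_mx_Zp_eq1 => //; rewrite rmorphM /= ME mx_reprK.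
  exact: (congr1 val (mulgV A)).
have dvd_a k : eq1_mod N (M ^+ k)%R -> a %| k.
  move=> Mk; rewrite order_dvdn -val_eqE /= FinRing.val_unitX -ME -rmorphXn /=.
  by rewrite (eq1_mod_rmorph (map_mx intr) (natr_Zp_mx_eq0 m N1) Mk).
have a_dvd1 : a %| N * nablam m.+1 n * Dm m.+1 n.
  have -> : N * nablam m.+1 n * Dm m.+1 n = Km m.+1 n * p ^ vmP m.+1 P p.
    by rewrite /N /Km -!mulnA mulnC !mulnA.
  apply: dvd_a; rewrite exprM; apply: eq1_modX_lift.
    by have := pn; rewrite mem_primes => /and3P[].
  apply: map_mx_Zp_eq1 => //; rewrite rmorphXn /=.
  (* As [n] divides [N], the lift of the inverse also inverts [M] modulo [n], so [hC] applies to the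
     reduction of [M]. *)
  have /mulmx1_unit[Mu _] : (map_mx intr M *m map_mx intr V = 1%:M :> 'M['Z_n]_m.+1)%R.
    have := eq1_mod_rmorph (map_mx intr) (natr_Zp_mx_eq0 m n1) (eq1_mod_dvd nN MVN).
    by rewrite rmorphM.
  by have := congr1 val (hC (FinRing.Unit Mu)); rewrite FinRing.val_unitX.
have a_dvd2 : a %| DmP m.+1 P * N ^ m.+1 * N ^ N.
  apply: dvd_a; apply: eq1_mod_expr_unit MVN _ => // q j; rewrite NPn nP => qP jm.
  apply: dvdn_trans (dvdn_expB1_Dm (prime_gt1 (hP q qP)) jm) _.
  by rewrite /DmP (big_rem q) //= dvdn_lcml.
have Dn0 : 0 < Dm m.+1 n.
  (* If D_m(n) were 0, its gcd with n would be n > 1. *)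
  have := coprime_Dm m.+1 n1; case: posnP => // ->.
  by rewrite /coprime gcdn0 gtn_eqF.
have pi'D : pi^'.-nat (Dm m.+1 n).
  apply/pnatP=> // q q_pr qD; rewrite !inE /= -nP mem_primes q_pr n0 /= -prime_coprime //.
  by apply: coprime_dvdl qD _; rewrite coprime_sym coprime_Dm.
have DP0 : 0 < DmP m.+1 P by apply: DmP_gt0.
have pi'D'' : pi^'.-nat (DmP'' m.+1 P) by apply: part_pnat.
have eqNn : N = n %[mod DmP'' m.+1 P].
  have /eqP : p ^ vmP m.+1 P p == 1 %[mod DmP'' m.+1 P].
    rewrite mulorderP ?part_gt0 //; apply: pnat_coprime pi'D''.
    by rewrite pnatE ?inE.
  by rewrite /N -modnMml => ->; rewrite modnMml mul1n.
rewrite /Km nablaE -(partnC pi a0) Gauss_dvd ?coprime_partC //; apply/andP; split.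
  apply: dvdn_mulr; rewrite -(@Gauss_dvdl _ _ (Dm m.+1 n)).
    exact: dvdn_trans (dvdn_part _ _) a_dvd1.
  exact: pnat_coprime (part_pnat _ _) pi'D.
apply: dvdn_mull.
have aD : a`_pi^' %| Dm m.+1 n.
  rewrite -(@Gauss_dvdr _ (N * nablam m.+1 n)).
    exact: dvdn_trans (dvdn_part _ _) a_dvd1.
  by rewrite coprime_sym (pnat_coprime _ (part_pnat _ _)) // pnatM piN.
have aD'' : a`_pi^' %| DmP'' m.+1 P.
  rewrite -[a`_ _](part_pnat_id (part_pnat pi^' a)); apply: partn_dvd => //.
  rewrite -(@Gauss_dvdl _ _ (N ^ m.+1 * N ^ N)) ?mulnA; last first.
    by rewrite coprime_sym (pnat_coprime _ (part_pnat _ _)) // pnatM !pnatX piN.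
  exact: dvdn_trans (dvdn_part _ _) a_dvd2.
(* The prime-to-P part of [a] divides D_m''(P), so [N] and [n] are congruent modulo it, and its
   divisibility into D_m(n) passes to D_m(N). *)
rewrite (@dvdn_Dm_congr _ _ N n) //.
by rewrite -(modn_dvdm N aD'') eqNn modn_dvdm.
Qed.
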